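(* For $n\ge 3$, the alternating sign matrix polytope $ASM_n$ has exactly $4[(n-2)^2+1]$ facets.
   Context: An alternating sign matrix (ASM) is a square matrix with entries in $\{0,1,-1\}$ such that the entries of each row and each column sum to $1$, and the nonzero entries in each row and each column alternate in sign. $ASM_n$ is the convex hull in $\mathbb{R}^{n^2}$ of the $n\times n$ alternating sign matrices. A facet is a face of dimension one less than the dimension of the polytope. *)

(* Defs.v *)
From HB Require Import structures.
From mathcomp Require Import all_boot all_order all_algebra.
From mathcomp Require Import boolp classical_sets functions cardinality reals.

Set Implicit Arguments.
Unset Strict Implicit.
Unset Printing Implicit Defensive.

Import Order.TTheory GRing.Theory Num.Theory.

Local Open Scope classical_set_scope.
Local Open Scope ring_scope.

Section Polytopes.
Variables (R : realType) (V : vectType R).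
Implicit Types S P F : set V.

Definition convex_hull S : set V :=
  [set x | exists (k : nat) (w : 'I_k -> R) (p : 'I_k -> V),
    [/\ forall i, 0 <= w i, \sum_i w i = 1, forall i, S (p i)
      & x = \sum_i w i *: p i]].

Definition affine_hull S : set V :=
  [set x | exists (k : nat) (w : 'I_k -> R) (p : 'I_k -> V),
    [/\ \sum_i w i = 1, forall i, S (p i) & x = \sum_i w i *: p i]].

(* The dimension of a set is that of its affine hull, which for a nonempty set
   is a translate of a linear subspace; the empty set has dimension -1. *)
Definition has_dim S (d : int) : Prop :=
  (S = set0 /\ d = - 1) \/
  (exists (x : V) (U : {vspace V}),
     affine_hull S = [set x + u | u in [set u : V | u \in U]] /\ d = (\dim U)%:Z).

(* f = 0 yields P itself and the empty set, which count as faces. *)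
Definition is_face P F : Prop :=
  exists (f : {scalar V}) (c : R),
    (forall x, P x -> f x <= c) /\ F = P `&` [set x | f x = c].

Definition is_facet P F : Prop :=
  is_face P F /\ exists d : int, has_dim F d /\ has_dim P (d + 1).

End Polytopes.

Section ASM.
Variables (R : realType) (n : nat).

Definition alternates (f : 'I_n -> R) : Prop :=
  forall j k : 'I_n, (j < k)%N -> f j != 0 -> f k != 0 ->
    (forall l : 'I_n, (j < l < k)%N -> f l = 0) ->
    Num.sg (f k) = - Num.sg (f j).

Definition is_asm (A : 'M[R]_n) : Prop :=
  [/\ forall i j, A i j \in [:: 0; 1; -1],
      forall i, \sum_j A i j = 1,
      forall j, \sum_i A i j = 1,
      forall i, alternates (fun j => A i j)
    & forall j, alternates (fun i => A i j)].

Definition asm_polytope : set 'M[R]_n := convex_hull [set A | is_asm A].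

End ASM.

Arguments asm_polytope R n : clear implicits.

(* Main.v *)
Require Import Defs.
From HB Require Import structures.
From mathcomp Require Import all_boot all_order all_algebra.
From mathcomp Require Import boolp classical_sets functions cardinality reals.
From mathcomp Require Import zify ring lra.

Set Implicit Arguments.
Unset Strict Implicit.
Unset Printing Implicit Defensive.

Import Order.TTheory GRing.Theory Num.Theory.

Local Open Scope classical_set_scope.
Local Open Scope ring_scope.

(** Let [C i j] be the sum of the entries of [A] in its first [i] rows and [j]
    columns.  A matrix with unit row and column sums is an ASM iff [C] is integral
    and neighbouring values of [C] differ by 0 or 1; if they only differ by a real
    in [0, 1], rounding [C i j] to [floor (C i j + t)] for all [t] in [0, 1) exhibits
    [A] as an average of ASMs.  Hence the polytope is cut out, within the matrices
    with unit sums, by requiring that every initial segment of a line, read from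
    any of the four borders, has a nonnegative sum.

    Up to rotation by a quarter turn, all these inequalities follow from those for
    the top left entry and for the top [i] entries of an inner column, with
    [1 <= i <= n - 2]: that is [1 + (n - 2)^2] inequalities on each of the four
    sides.  Each of them is tight at some point of the polytope where all the
    others are strict, so they define distinct facets, and there are no others. *)

(** * Kernels of scalar forms *)

Section ScalarKernel.
Variables (R : realType) (V : vectType R) (f : {scalar V}).

(** The codomain [R^o] is [R] seen as a vector space of dimension one, so that [linfun] and the rank
    formula apply. *)
Let fo (x : V) : R^o := f x.

Fact fo_is_linear : linear fo.
Proof. by move=> a u v; rewrite /fo linearP. Qed.

HB.instance Definition _ := GRing.isLinear.Build R V R^o *:%R fo fo_is_linear.

Lemma dim_scalar_ker (U : {vspace V}) (u0 : V) : u0 \in U -> f u0 != 0 ->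
  exists2 W : {vspace V}, (forall u, (u \in W) = (u \in U) && (f u == 0))
    & \dim U = (\dim W).+1.
Proof.
move=> Uu0 fu0; exists (U :&: lker (linfun fo))%VS.
  by move=> u; rewrite memv_cap memv_ker lfunE.
rewrite -(limg_ker_dim (linfun fo) U) -addn1; congr addn.
apply/eqP; rewrite eqn_leq; apply/andP; split.
  by apply: leq_trans (dimvS (subvf _)) _; rewrite dimvf.
rewrite lt0n dimv_eq0; apply: contra fu0 => /eqP img0.
have := memv_img (linfun fo) Uu0.
by rewrite img0 memv0 lfunE.
Qed.

End ScalarKernel.

(** * Affine hulls and dimension *)

Section AffineDimension.
Variables (R : realType) (V : vectType R).
Implicit Types (S T : set V) (x y : V) (U W : {vspace V}).

Lemma subset_affine_hull S : S `<=` affine_hull S.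
Proof.
move=> x Sx; exists 1%N, (fun=> 1), (fun=> x).
by split=> //; rewrite big_ord_recl big_ord0 addr0 // scale1r.
Qed.

Lemma affine_hullS S T : S `<=` T -> affine_hull S `<=` affine_hull T.
Proof.
move=> sST x [k [w [p [w1 Sp ->]]]].
by exists k, w, p; split=> // i; apply: sST.
Qed.

Lemma affine_hull_translate S x U :
    S x -> (forall y, S y -> y - x \in U) ->
    (forall u, u \in U -> exists2 e : R, 0 < e & S (x + e *: u)) ->
  affine_hull S = [set x + u | u in [set u : V | u \in U]].
Proof.
move=> Sx SU US; apply/seteqP; split=> [y [k [w [p [w1 Sp ->]]]]|_ [u /= Uu <-]].
  exists (\sum_i w i *: (p i - x)); first by apply: memv_suml => i _; rewrite memvZ // SU.
  under eq_bigr do rewrite scalerBr.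
  by rewrite sumrB -scaler_suml w1 scale1r addrC subrK.
have [e e_gt0 Se] := US _ Uu.
(* [x + u] is the affine combination of [x] and [x + e *: u] with weights [1 - e^-1], possibly
   negative, and [e^-1]. *)
exists 2%N, (fun i => if i == ord0 then 1 - e^-1 else e^-1),
  (fun i => if i == ord0 then x else x + e *: u).
split; first by rewrite !big_ord_recl big_ord0 /= addr0 subrK.
  by move=> i; case: ifP.
rewrite !big_ord_recl big_ord0 /= addr0 scalerDr scalerA mulVf ?gt_eqF //.
by rewrite scale1r addrA -scalerDl subrK scale1r.
Qed.

Lemma translate_subv x y U W :
    [set x + u | u in [set u : V | u \in U]] `<=`
      [set y + u | u in [set u : V | u \in W]] -> (U <= W)%VS.
Proof.
move=> sUW; apply/subvP => u Uu.
have [|w /= Ww xw] := sUW (x + u); first by exists u.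
have [|w0 /= Ww0 xw0] := sUW (x + 0); first by exists 0 => //=; exact: mem0v.
have -> : u = w - w0.
  have <- : y + w - (y + w0) = w - w0 by rewrite opprD addrACA subrr add0r.
  by rewrite xw xw0 addr0 addrC addKr.
by rewrite memvB.
Qed.

Lemma affine_hull0 : affine_hull (set0 : set V) = set0.
Proof.
apply/seteqP; split=> // x [[|k] [w [p [w1 Sp _]]]]; last exact: Sp ord0.
by move: w1; rewrite big_ord0 => /eqP; rewrite eq_sym oner_eq0.
Qed.

Lemma has_dim_inj S d d' : has_dim S d -> has_dim S d' -> d = d'.
Proof.
move=> [[S0 ->]|[x [U [SU ->]]]] [[S0' ->]|[x' [U' [SU' ->]]]] //.
- suff: affine_hull S (x' + 0) by rewrite S0 affine_hull0.
  by rewrite SU'; exists 0 => //=; exact: mem0v.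
- suff: affine_hull S (x + 0) by rewrite S0' affine_hull0.
  by rewrite SU; exists 0 => //=; exact: mem0v.
- suff -> : U = U' by [].
  by apply/eqP; rewrite eqEsubv; apply/andP; split;
    [apply: (@translate_subv x x')|apply: (@translate_subv x' x)]; rewrite -SU -SU'.
Qed.

(** Equal dimensions turn the inclusion of direction spaces into an equality, and two translates of
    one subspace that share a point coincide. *)
Lemma affine_hull_eq_dim S T d : S !=set0 -> S `<=` T ->
  has_dim S d -> has_dim T d -> affine_hull S = affine_hull T.
Proof.
move=> [s Ss] sST [[S0 _]|[x [U [SU ->]]]]; first by rewrite S0 in Ss.
case=> [[_ //]|[y [W [TW [dimUW]]]]].
have sh : affine_hull S `<=` affine_hull T by exact: affine_hullS.
have sUW : (U <= W)%VS by apply: (@translate_subv x y); rewrite -SU -TW.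
have eUW : U = W by apply/eqP; rewrite eqEdim sUW dimUW /=.
apply/seteqP; split=> // z; rewrite SU TW eUW => -[w /= Ww <-].
have [w0 /= Ww0 xw0] : [set y + u | u in [set u : V | u \in W]] (x + 0).
  by rewrite -TW; apply: sh; rewrite SU; exists 0 => //=; exact: mem0v.
rewrite addr0 in xw0; rewrite -xw0.
by exists (w - w0) => /=; rewrite ?memvB // -addrA [w0 + _]addrC subrK.
Qed.

End AffineDimension.

(** * Facets of a polyhedron given by irredundant inequalities *)

Section FacetsOfInequalities.
Variables (R : realType) (V : vectType R) (P : set V) (x0 : V) (U : {vspace V}).
Variables (K : finType) (l : K -> {scalar V}) (w : K -> V).
Hypothesis PE : forall x, P x <-> (x - x0 \in U /\ forall k, 0 <= l k x).
Hypothesis Pw : forall k, P (w k).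
Hypothesis lw0 : forall k, l k (w k) = 0.
Hypothesis lw_gt0 : forall k k', k' != k -> 0 < l k' (w k).
Hypothesis card_gt1 : (1 < #|K|)%N.

Definition tight_face k : set V := P `&` [set x | l k x = 0].

Lemma polyhedron_sub x y : P x -> P y -> y - x \in U.
Proof.
move=> /PE[Ux _] /PE[Uy _]; have <- : (y - x0) - (x - x0) = y - x.
  by rewrite opprB addrA subrK.
by rewrite memvB.
Qed.

Lemma polyhedron_shift x u : P x -> u \in U -> (forall k, l k x = 0 -> 0 <= l k u) ->
  exists2 e : R, 0 < e & P (x + e *: u).
Proof.
move=> Px Uu Hu; have [Ux Lx] := (PE x).1 Px.
have s_ge0 : 0 <= \sum_k `|l k u| / l k x.
  by apply: sumr_ge0 => k _; rewrite divr_ge0.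
(* Wherever [l k x] is nonzero, [e * |l k u| <= l k x] is wanted. The sum bounds all ratios at once;
   those with [l k x = 0] count as 0, and the added 1 keeps it positive. *)
pose e := (1 + \sum_k `|l k u| / l k x)^-1.
have e_gt0 : 0 < e by rewrite invr_gt0; lra.
exists e => //; apply/PE; split.
  by rewrite addrAC memvD // memvZ.
move=> k; rewrite linearD linearZ /=.
have [lx0|lx] := eqVneq (l k x) 0.
  by rewrite lx0 add0r mulr_ge0 ?Hu // ltW.
have lx_gt0 : 0 < l k x by rewrite lt_neqAle eq_sym lx Lx.
have He : `|l k u| <= l k x / e.
  rewrite -ler_pdivrMl // /e invrK mulrC (bigD1 k) //=.
  have : 0 <= \sum_(i | i != k) `|l i u| / l i x.
    by apply: sumr_ge0 => i _; rewrite divr_ge0.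
  by move=> ?; lra.
have : e * `|l k u| <= l k x by rewrite mulrC -ler_pdivlMr.
have : e * - `|l k u| <= e * l k u by rewrite ler_pM2l // lerNnormlW.
by rewrite mulrN; lra.
Qed.

Lemma exists_other (k : K) : exists k', k' != k.
Proof.
have /card_gt1P[k1 [k2 [_ _ k12]]] := card_gt1.
have [k1k|] := eqVneq k1 k; last by exists k1.
by exists k2; rewrite -k1k eq_sym.
Qed.

Lemma direction_neq0 k : exists2 u, u \in U & l k u != 0.
Proof.
have [k' k'k] := exists_other k; exists (w k' - w k); first exact: polyhedron_sub.
by rewrite linearB /= lw0 subr0 gt_eqF // lw_gt0 // eq_sym.
Qed.

Lemma has_dim_polyhedron x : P x -> (forall k, 0 < l k x) -> has_dim P (\dim U)%:Z.
Proof.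
move=> Px lx; right; exists x, U; split=> //.
apply: affine_hull_translate => // [y Py|u Uu]; first exact: polyhedron_sub.
by apply: polyhedron_shift => // k lk0; have := lx k; rewrite lk0 ltxx.
Qed.

(** The barycentre of the [x k] works: each inequality is strict at one of them and holds at the
    others, while [f] keeps its common value. *)
Lemma average_slack (f : {scalar V}) (c : R) (k0 : K) (x : K -> V) :
    (forall k, P (x k) /\ f (x k) = c) -> (forall k, 0 < l k (x k)) ->
  exists y, [/\ P y, f y = c & forall k, 0 < l k y].
Proof.
move=> Px lx; have K_gt0 : (0 < #|K|)%N by apply/card_gt0P; exists k0.
have K_neq0 : #|K|%:R != 0 :> R by rewrite pnatr_eq0 -lt0n.
pose y := #|K|%:R^-1 *: \sum_k x k.
have ly k : l k y = #|K|%:R^-1 * \sum_i l k (x i) by rewrite linearZ linear_sum.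
have ly_gt0 k : 0 < l k y.
  rewrite ly mulr_gt0 ?invr_gt0 ?ltr0n // (bigD1 k) //= ltr_pwDl //.
  by apply: sumr_ge0 => i _; have [/PE[]] := Px i.
exists y; split=> //.
  apply/PE; split=> [|k]; last exact: ltW.
  have -> : y - x0 = #|K|%:R^-1 *: \sum_k (x k - x0).
    rewrite sumrB scalerBr; congr (_ - _).
    by rewrite sumr_const -scaler_nat scalerA mulVf // scale1r.
  by rewrite memvZ // memv_suml // => i _; have [/PE[]] := Px i.
rewrite /y linearZ linear_sum /=; under eq_bigr do rewrite (Px _).2.
by rewrite sumr_const -[c *+ _]mulr_natl mulrA mulVf // mul1r.
Qed.

Lemma exists_slack : exists2 y, P y & forall k, 0 < l k y.
Proof.
have [k0 _] : exists k : K, k \in K by apply/card_gt0P; apply: ltnW.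
have [x /= xk] := choice exists_other.
(* With the zero form the condition on [f] is void; the point chosen for [k] is the witness of
   another index. *)
have [|k|y [Py _ ly]] := @average_slack \0 0 k0 (fun k => w (x k)).
- by move=> k; split.
- by apply: lw_gt0; rewrite eq_sym.
- by exists y.
Qed.

(** All other inequalities are strict at [w k], so the face allows a small step from there in every
    direction of [U] killed by [l k], a subspace of codimension one. *)
Lemma tight_face_facet k : is_facet P (tight_face k).
Proof.
split.
  exists (\- l k), 0; split=> [x /PE[_ lx]|]; first by rewrite /= oppr_le0.
  apply/seteqP; split=> x [Px /= lx]; split=> //=; first by rewrite lx oppr0.
  by apply: oppr_inj; rewrite oppr0.
have [u0 Uu0 lu0] := direction_neq0 k.
have [W WE dimUW] := dim_scalar_ker Uu0 lu0.
exists (\dim W)%:Z; split; last first.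
  have [y Py ly] := exists_slack.
  by have := has_dim_polyhedron Py ly; rewrite dimUW -addn1 PoszD.
right; exists (w k), W; split=> //; apply: affine_hull_translate.
- by split; [apply: Pw|apply: lw0].
- by move=> y [Py /= ly]; rewrite WE polyhedron_sub //= linearB /= ly lw0 subrr.
- move=> u; rewrite WE => /andP[Uu /eqP lu].
  have [k' lk'|e e0 Pe] := @polyhedron_shift (w k) u (Pw k) Uu.
    have [->|kk'] := eqVneq k' k; first by rewrite lu.
    by have := lw_gt0 kk'; rewrite lk' ltxx.
  by exists e => //; split=> //=; rewrite linearD linearZ /= lu mulr0 lw0 addr0.
Qed.

(** A facet inside some tight face has the same affine hull, by dimension, and [f] is constant on
    it. Otherwise averaging yields a point of [F] where all inequalities are strict, which forces
    [F = P]. *)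
Lemma facet_tight_face F : is_facet P F -> exists k, F = tight_face k.
Proof.
move=> [[f [c [fc FE]]] [d [dimF dimP]]].
have [k0 _] : exists k : K, k \in K by apply/card_gt0P; apply: ltnW.
have [y0 Py0 ly0] := exists_slack.
have dimU := has_dim_inj (has_dim_polyhedron Py0 ly0) dimP.
(* An empty [F] has dimension -1, so [P] would have dimension 0; but some form is nonzero on [U]. *)
have F0 : F !=set0.
  apply/set0P/eqP => F0; have d1 : d = - 1.
    by apply: (has_dim_inj dimF); left.
  have [u Uu lu] := direction_neq0 k0.
  have [W _ dimUW] := dim_scalar_ker Uu lu.
  by move: dimU; rewrite d1 dimUW; lia.
have [[k Fk]|noF] := pselect (exists k, F `<=` tight_face k).
  exists k; apply/seteqP; split=> // x [Px lx].
  have [_ [d' [dimk dimP']]] := tight_face_facet k.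
  have dd' : d = d' by have := has_dim_inj dimP dimP'; lia.
  rewrite FE; split=> //=.
  have := @affine_hull_eq_dim _ _ _ _ d F0 Fk dimF; rewrite dd' => /(_ dimk) hE.
  have : affine_hull F x by rewrite hE; apply: subset_affine_hull.
  move=> [m [a [p [a1 Fp ->]]]]; rewrite linear_sum /=.
  rewrite -[RHS]mul1r -a1 mulr_suml; apply: eq_bigr => i _.
  by rewrite linearZ /=; have := Fp i; rewrite FE => -[_ /= ->].
have Hx k : exists x, [/\ P x, f x = c & 0 < l k x].
  apply: contrapT => noX; apply: noF; exists k => x; rewrite FE => -[Px /= fx].
  split=> //=; apply/eqP; rewrite eq_le ((PE x).1 Px).2 andbT leNgt.
  by apply/negP => lx; apply: noX; exists x.
have [x /= xk] := choice Hx.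
have [||y [Py fy ly]] := @average_slack f c k0 x.
- by move=> k; have [] := xk k.
- by move=> k; have [] := xk k.
suff FP : F = P by have := has_dim_inj dimF; rewrite FP => /(_ _ dimP); lia.
rewrite FE; apply/seteqP; split=> [z []//|z Pz]; split=> //=.
(* A small step from [y] away from [z] stays in [P], so [f z < c] would push [f] above [c]. *)
have [||e e_gt0 Pe] := @polyhedron_shift y (y - z) Py; first exact: polyhedron_sub.
  by move=> k lk; have := ly k; rewrite lk ltxx.
have := fc _ Pe; rewrite linearD linearZ linearB /= fy gerDl.
rewrite pmulr_rle0 // subr_le0 => cz.
by apply/eqP; rewrite eq_le cz fc.
Qed.

Lemma tight_face_inj : injective tight_face.
Proof.
move=> k k' E; have [_ /= lk] : tight_face k' (w k).
  by rewrite -E; split; [apply: Pw|apply: lw0].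
apply/eqP; apply: contraT => kk'.
by have := lw_gt0 (k := k) (k' := k'); rewrite eq_sym lk ltxx => ->.
Qed.

Lemma card_facets : ([set F | is_facet P F] #= `I_#|K|)%card.
Proof.
(* The value [set0] is a filler outside the indices counted. *)
pose h i := if insub i is Some j then tight_face (enum_val (j : 'I_#|K|)) else set0.
have -> : [set F | is_facet P F] = [set h i | i in `I_#|K|].
  apply/seteqP; split=> [F /facet_tight_face[k ->]|_ [i /= iK <-]].
    by exists (enum_rank k) => //=; rewrite /h valK enum_rankK.
  by rewrite /h insubT; apply: tight_face_facet.
apply: inj_card_eq => i j; rewrite !inE /= => iK jK.
by rewrite /h !insubT => /tight_face_inj/enum_val_inj[].
Qed.

End FacetsOfInequalities.

(** * Convex hulls *)

Section ConvexHull.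
Variables (R : realType) (V : vectType R).
Implicit Types S : set V.

Lemma subset_convex_hull S : S `<=` convex_hull S.
Proof.
move=> x Sx; exists 1%N, (fun=> 1), (fun=> x).
by split=> // [|]; rewrite big_ord_recl big_ord0 addr0 // scale1r.
Qed.

Lemma convex_hull_convex S (t : R) x y : 0 <= t <= 1 ->
  convex_hull S x -> convex_hull S y -> convex_hull S (t *: x + (1 - t) *: y).
Proof.
move=> /andP[t0 t1] [k [w [p [w0 w1 Sp ->]]]] [k' [w' [p' [w0' w1' Sp' ->]]]].
exists (k + k')%N,
  (fun i => match fintype.split i with inl a => t * w a | inr b => (1 - t) * w' b end),
  (fun i => match fintype.split i with inl a => p a | inr b => p' b end).
split.
- by move=> i; case: fintype.split => a; rewrite mulr_ge0 ?subr_ge0.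
- rewrite big_split_ord /=.
  under eq_bigr do rewrite (unsplitK (inl _)).
  under [X in _ + X]eq_bigr do rewrite (unsplitK (inr _)).
  by rewrite -!mulr_sumr w1 w1' !mulr1 addrC subrK.
- by move=> i; case: fintype.split.
- rewrite big_split_ord /=.
  under [X in _ = X + _]eq_bigr do rewrite (unsplitK (inl _)) -scalerA.
  under [X in _ = _ + X]eq_bigr do rewrite (unsplitK (inr _)) -scalerA.
  by rewrite -!scaler_sumr.
Qed.

Lemma convex_hull_ge0 (f : {scalar V}) S x :
  (forall y, S y -> 0 <= f y) -> convex_hull S x -> 0 <= f x.
Proof.
move=> fS [k [w [p [w0 w1 Sp ->]]]]; rewrite linear_sum /=.
by apply: sumr_ge0 => i _; rewrite linearZ mulr_ge0 // fS.
Qed.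

Lemma convex_hull_subv (U : {vspace V}) x0 S x :
  (forall y, S y -> y - x0 \in U) -> convex_hull S x -> x - x0 \in U.
Proof.
move=> SU [k [w [p [w0 w1 Sp ->]]]].
rewrite -[x0]scale1r -w1 scaler_suml -sumrB memv_suml // => i _.
by rewrite -scalerBr memvZ // SU.
Qed.

End ConvexHull.

(** * Partial sums of alternating sequences *)

Section PartialSums.
Variables (R : realType) (n : nat).
Implicit Types (f g : 'I_n -> R) (h : nat -> R).

Definition psum f (i : nat) : R := \sum_(l < n | (l < i)%N) f l.

Lemma psum0 f : psum f 0 = 0.
Proof. by rewrite /psum big_pred0. Qed.

Lemma eq_psum f g i : f =1 g -> psum f i = psum g i.
Proof. by move=> fg; apply: eq_bigr. Qed.

Lemma psumS f (i : 'I_n) : psum f i.+1 = psum f i + f i.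
Proof.
rewrite /psum (bigD1 i) //= addrC; congr (_ + _); apply: eq_bigl => l.
by rewrite -val_eqE /=; lia.
Qed.

Lemma psum_full f i : (n <= i)%N -> psum f i = \sum_l f l.
Proof.
by move=> ni; apply: eq_bigl => l; rewrite (leq_trans _ ni).
Qed.

Lemma psum_rev f i : psum (fun l => f (rev_ord l)) i = \sum_l f l - psum f (n - i).
Proof.
rewrite [in RHS](bigID (fun l : 'I_n => (l < n - i)%N)) /= -/(psum f (n - i)).
rewrite addrAC subrr add0r.
rewrite /psum (reindex_inj rev_ord_inj) /=; apply: eq_big => [l|l _].
  by rewrite /=; have := ltn_ord l; lia.
by rewrite rev_ordK.
Qed.

Lemma psum_telescope h i : (i <= n)%N ->
  psum (fun l => h l.+1 - h l) i = h i - h 0%N.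
Proof.
elim: i => [|i IH] lin; first by rewrite psum0 subrr.
by rewrite (psumS _ (Ordinal lin)) IH 1?ltnW //= addrC addrA subrK.
Qed.

Lemma psum_ge0 f i : (forall l, 0 <= f l) -> 0 <= psum f i.
Proof. by move=> f0; apply: sumr_ge0. Qed.

(** Entry [p] outweighs [q], the only one allowed to be negative; [p] and [q] may coincide. *)
Lemma psum_gt0 f i (p q : 'I_n) (e : R) : 0 <= e -> (p < i)%N -> e < f p ->
    (forall l : 'I_n, (l < i)%N -> l != q -> 0 <= f l) -> - e <= f q ->
  0 < psum f i.
Proof.
move=> e0 pi fp f0 fq; rewrite /psum (bigD1 p) //=.
have [/andP[qi qp]|nq] := boolP ((q < i)%N && (q != p)).
  rewrite (bigD1 q) /=; last by rewrite qi.
  have : 0 <= \sum_(l < n | (l < i)%N && (l != p) && (l != q)) f l.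
    by apply: sumr_ge0 => l /andP[/andP[li _] lq]; apply: f0.
  by move=> ?; lra.
rewrite ltr_pwDl ?(le_lt_trans e0) //; apply: sumr_ge0 => l /andP[li lp].
by apply: f0 => //; apply: contraNneq nq => <-; rewrite li.
Qed.

(** By alternation the partial sums only take the values 0 and [a], the first nonzero entry; the
    total 1 forces [a = 1]. *)
Lemma alternates_psum f : (forall i, f i \in [:: 0; 1; -1]) ->
  \sum_i f i = 1 -> alternates f -> forall i, 0 <= psum f i <= 1.
Proof.
move=> f01 f1 alt.
pose is_last i (p : 'I_n) := (p < i)%N /\ forall l : 'I_n, (p < l < i)%N -> f l = 0.
(* [a] is the first nonzero entry, arbitrary while there is none. The last clause links the current
   sum to the last nonzero entry: [a] after an [a], 0 after a [- a]. *)
have inv i : (i <= n)%N -> exists a : R, [/\ a = 1 \/ a = -1,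
    forall j, (j <= i)%N -> psum f j = 0 \/ psum f j = a
    & [\/ forall l : 'I_n, (l < i)%N -> f l = 0,
          psum f i = a /\ (exists2 p, is_last i p & f p = a)
        | psum f i = 0 /\ (exists2 p, is_last i p & f p = - a)]].
  elim: i => [|i IH] lin.
    exists 1; split; [by left| |by constructor 1].
    by move=> j; rewrite leqn0 => /eqP->; left; rewrite psum0.
  have [a [a1 Ha st]] := IH (ltnW lin).
  pose o := Ordinal lin; have SE := psumS f o; rewrite /= in SE.
  have ext b : b = 1 \/ b = -1 -> (forall j, (j <= i)%N -> psum f j = 0 \/ psum f j = b) ->
      psum f i.+1 = 0 \/ psum f i.+1 = b ->
      forall j, (j <= i.+1)%N -> psum f j = 0 \/ psum f j = b.
    by move=> _ Hb Hi j; rewrite leq_eqVlt => /orP[/eqP->|/Hb].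
  have [fo0|fo_neq0] := eqVneq (f o) 0.
    rewrite fo0 addr0 in SE.
    have keep p : is_last i p -> is_last i.+1 p.
      move=> [pi pl]; split=> [|l /andP[pl' li]]; first exact: ltnW.
      have [lo|li'] := eqVneq (l : nat) i; last by apply: pl; lia.
      by have -> : l = o by apply: val_inj.
    exists a; split=> //; first by apply: ext => //; rewrite SE; apply: Ha.
    case: st => [z|[Si [p lp fp]]|[Si [p lp fp]]]; [constructor 1|constructor 2|constructor 3].
    - move=> l li; have [lo|li'] := eqVneq (l : nat) i; last by apply: z; lia.
      by have -> : l = o by apply: val_inj.
    - by rewrite SE; split=> //; exists p => //; apply: keep.
    - by rewrite SE; split=> //; exists p => //; apply: keep.
  have fo1 : f o = 1 \/ f o = -1.
    have := f01 o; rewrite !inE (negbTE fo_neq0) /=.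
    by case/orP => /eqP; [left|right].
  have lasto : is_last i.+1 o by split=> // l /=; lia.
  have flip p : is_last i p -> f p = 1 \/ f p = -1 -> f o = - f p.
    move=> [pi pl] fp.
    have := alt p o pi _ fo_neq0 pl.
    by case: fp => ->; case: fo1 => ->; rewrite ?sgrN ?sgr1 ?oppr_eq0 oner_eq0 => /(_ isT) ?; lra.
  case: st => [z|[Si [p lp fp]]|[Si [p lp fp]]].
  - have S0 j : (j <= i)%N -> psum f j = 0.
      by move=> ji; apply: big1 => l lj; apply: z; apply: leq_trans lj ji.
    have Si1 : psum f i.+1 = f o by rewrite SE S0 // add0r.
    exists (f o); split=> //; last by constructor 2; split=> //; exists o.
    by apply: ext => // [j /S0|]; [left|right].
  - have fo : f o = - a by rewrite -fp; apply: flip; rewrite ?fp.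
    have Si1 : psum f i.+1 = 0 by rewrite SE fo Si subrr.
    exists a; split=> //; first by apply: ext => //; left.
    by constructor 3; split=> //; exists o.
  - have fo : f o = a.
      rewrite -[RHS]opprK -fp; apply: flip; rewrite ?fp //.
      by case: a1 => ->; rewrite ?opprK; [right|left].
    have Si1 : psum f i.+1 = a by rewrite SE fo Si add0r.
    exists a; split=> //; first by apply: ext => //; right.
    by constructor 2; split=> //; exists o.
have [a [a1 Ha _]] := inv n (leqnn n).
have a_eq1 : a = 1.
  have [] := Ha n (leqnn n); rewrite psum_full // f1 // => /eqP.
  by rewrite oner_eq0.
move=> i; have [ni|/ltnW ni] := leqP n i; first by rewrite psum_full // f1 ler01 lexx.
by have [->|->] := Ha i ni; rewrite ?a_eq1 ?lexx ?ler01.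
Qed.

(** Between consecutive nonzero differences [h] is constant, so after a step up only a step down can
    follow, and conversely. *)
Lemma diff_alternates h f : (forall i, (i <= n)%N -> h i = 0 \/ h i = 1) ->
  h 0%N = 0 -> h n = 1 -> (forall i : 'I_n, f i = h i.+1 - h i) ->
  [/\ forall i, f i \in [:: 0; 1; -1], \sum_i f i = 1 & alternates f].
Proof.
move=> h01 h0 hn fE; split.
- move=> i; rewrite fE !inE.
  by have [->|->] := h01 i (ltnW (ltn_ord i)); have [->|->] := h01 _ (ltn_ord i);
    rewrite ?subrr ?subr0 ?sub0r ?eqxx ?orbT.
- under eq_bigr do rewrite fE.
  by rewrite -(psum_full _ (leqnn n)) psum_telescope // h0 hn subr0.
- move=> j k jk fj fk f0.
  have hE m : (j < m <= k)%N -> h m = h j.+1.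
    elim: m => // m IH /andP[jm mk]; rewrite ltnS in jm.
    have [<-//|jm'] := eqVneq (j : nat) m.
    have jm2 : (j < m)%N by rewrite ltn_neqAle jm' jm.
    rewrite -IH ?jm2 1?ltnW //.
    have mn : (m < n)%N by apply: ltn_trans mk (ltn_ord k).
    by have := fE (Ordinal mn); rewrite f0 /= ?jm2 // => /esym/eqP; rewrite subr_eq0 => /eqP.
  have := hE k; rewrite jk leqnn => /(_ isT) hk.
  move: fj fk; rewrite !fE hk.
  have [->|->] := h01 j (ltnW (ltn_ord j)); have [->|->] := h01 _ (ltn_ord j);
  have [->|->] := h01 _ (ltn_ord k);
  by rewrite ?subrr ?subr0 ?sub0r ?eqxx // ?sgrN ?sgr1 ?opprK.
Qed.

End PartialSums.

(** * Rounding by floors *)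

Section Rounding.
Variable R : realType.
Implicit Types x y m : R.

Definition flr x : R := (Num.floor x)%:~R.

Lemma flr_le x : flr x <= x.
Proof. by rewrite /flr floor_le. Qed.

Lemma flr_gt x : x < flr x + 1.
Proof. by have /andP[_] := floor_itv x; rewrite intrD. Qed.

Lemma flr_int (z : int) : flr z%:~R = z%:~R.
Proof. by rewrite /flr intrKfloor. Qed.

Lemma flr_nat (k : nat) : flr k%:R = k%:R.
Proof. exact: (flr_int k%:Z). Qed.

Lemma flr_flr x : flr (flr x) = flr x.
Proof. exact: flr_int. Qed.

Lemma flr_step x y : 0 <= x - y <= 1 -> flr x = flr y \/ flr x = flr y + 1.
Proof.
move=> /andP[xy0 xy1].
have xy : Num.floor y <= Num.floor x by apply: le_floor; lra.
have yx : Num.floor x < Num.floor y + 2.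
  rewrite -(ltr_int R) intrD -!/(flr _).
  by have := flr_le x; have := flr_gt y; lra.
have [E|E] : Num.floor x = Num.floor y \/ Num.floor x = Num.floor y + 1 by lia.
  by left; rewrite /flr E.
by right; rewrite /flr E intrD.
Qed.

(* The average of [floor (x + t)] over [1 - m <= t < 1], if the fractional part
   of [x] is at most [m]. *)
Definition stretch m x : R := flr x + (x - flr x) / m.

(** If the floors agree, the difference is [(x - y) / m]. If they differ, it is
    [1 - (y + 1 - x) / m], where [y + 1 - x] lies between 0 and [m]. *)
Lemma stretch_step m x y : 0 < m -> x - flr x <= m -> y - flr y <= m ->
  0 <= x - y <= 1 -> 0 <= stretch m x - stretch m y <= 1.
Proof.
move=> m0 xm ym xy; rewrite /stretch.
have := flr_le x; have := flr_le y.
have [fx|fx] := flr_step xy; move/andP: xy => [xy0 xy1] y0 x0.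
  have -> : flr x + (x - flr x) / m - (flr y + (y - flr y) / m) = (x - y) / m.
    by rewrite fx; field; rewrite gt_eqF.
  by rewrite divr_ge0 ?(ltW m0) //= ler_pdivrMr // mul1r; lra.
have -> : flr x + (x - flr x) / m - (flr y + (y - flr y) / m)
          = 1 - (y + 1 - x) / m.
  by rewrite fx; field; rewrite gt_eqF.
have : 0 <= (y + 1 - x) / m <= 1.
  rewrite divr_ge0 ?(ltW m0) ?subr_ge0 //=; last lra.
  by rewrite ler_pdivrMr // mul1r; lra.
by lra.
Qed.

End Rounding.

(** * Corner sums and decomposition into ASMs *)

Section CornerSums.
Variables (R : realType) (n : nat).
Implicit Types (C : nat -> nat -> R) (A : 'M[R]_n).

(** Mixed second difference, which recovers a matrix from its corner sums. *)
Definition mxdiff C : 'M[R]_n :=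
  \matrix_(r, c) (C r.+1 c.+1 - C r c.+1 - (C r.+1 c - C r c)).

Definition is_corner_sum C : Prop :=
  [/\ [/\ forall j, C 0%N j = 0, forall i, C i 0%N = 0,
          forall i, (i <= n)%N -> C i n = i%:R
        & forall j, (j <= n)%N -> C n j = j%:R],
      forall i j, (i < n)%N -> (j <= n)%N -> 0 <= C i.+1 j - C i j <= 1
    & forall i j, (i <= n)%N -> (j < n)%N -> 0 <= C i j.+1 - C i j <= 1].

(** Meant for [phi] equal to [flr] or [stretch m], which fix the integers and hence the boundary
    values. *)
Lemma is_corner_sum_comp C (phi : R -> R) : is_corner_sum C ->
    (forall k : nat, phi k%:R = k%:R) ->
    (forall i j i' j', (i <= n)%N -> (j <= n)%N -> (i' <= n)%N -> (j' <= n)%N ->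
      0 <= C i j - C i' j' <= 1 -> 0 <= phi (C i j) - phi (C i' j') <= 1) ->
  is_corner_sum (fun i j => phi (C i j)).
Proof.
move=> [[C0 C0' Cn Cn'] Ch Cv] phiN phiC; split; first split.
- by move=> j; rewrite C0 (phiN 0%N).
- by move=> i; rewrite C0' (phiN 0%N).
- by move=> i ni; rewrite Cn.
- by move=> j nj; rewrite Cn'.
- by move=> i j ni nj; apply: phiC; rewrite ?Ch // ltnW.
- by move=> i j ni nj; apply: phiC; rewrite ?Cv // ltnW.
Qed.

Lemma flr_fixed_01 (x : R) : flr x = x -> 0 <= x <= 1 -> x = 0 \/ x = 1.
Proof.
move=> xE x01; have f01 : 0 <= Num.floor x <= 1.
  by rewrite -(ler0z R) -(lerz1 R) -/(flr x) xE.
have [E|E] : Num.floor x = 0 \/ Num.floor x = 1 by lia.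
  by left; rewrite -xE /flr E.
by right; rewrite -xE /flr E.
Qed.

Lemma flr_fixed_sub (x y : R) : flr x = x -> flr y = y -> flr (x - y) = x - y.
Proof. 
move=> xE yE; have -> : x - y = (Num.floor x - Num.floor y)%:~R.
  by rewrite intrB -!/(flr _) xE yE.
exact: flr_int.
 Qed.

(** Row [r] lists the differences of [C r.+1 j - C r j], a sequence of zeros and ones running from 0
    to 1; columns are similar. *)
Lemma mxdiff_asm C : is_corner_sum C ->
    (forall i j, (i <= n)%N -> (j <= n)%N -> flr (C i j) = C i j) ->
  is_asm (mxdiff C).
Proof.
move=> [[C0 C0' Cn Cn'] Ch Cv] Cint.
have rowP (r : 'I_n) := @diff_alternates R n (fun j => C r.+1 j - C r j)
  (fun c => mxdiff C r c).
have colP (c : 'I_n) := @diff_alternates R n (fun i => C i c.+1 - C i c)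
  (fun r => mxdiff C r c).
have {}rowP r : [/\ forall c, mxdiff C r c \in [:: 0; 1; -1],
    \sum_c mxdiff C r c = 1 & alternates (fun c => mxdiff C r c)].
  have rn := ltn_ord r.
  apply: rowP => [j nj|||c]; last by rewrite mxE.
  - apply: flr_fixed_01; last by apply: Ch.
    by apply: flr_fixed_sub; apply: Cint => //; apply: ltnW.
  - by rewrite !C0' subrr.
  - by rewrite !Cn ?(ltnW rn) // -natr1 addrC addKr.
have {}colP c : [/\ forall r, mxdiff C r c \in [:: 0; 1; -1],
    \sum_r mxdiff C r c = 1 & alternates (fun r => mxdiff C r c)].
  have cn := ltn_ord c.
  apply: colP => [j nj|||r]; last by rewrite mxE; ring.
  - apply: flr_fixed_01; last by apply: Cv.
    by apply: flr_fixed_sub; apply: Cint => //; apply: ltnW.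
  - by rewrite !C0 subrr.
  - by rewrite !Cn' ?(ltnW cn) // -natr1 addrC addKr.
by split=> [r c|r|c|r|c]; [have [] := rowP r|have [] := rowP r|have [] := colP c|
  have [] := rowP r|have [] := colP c].
Qed.

(** Induction on the number of nonintegral values. With [m] the largest fractional part, [C] is
    [1 - m] times its floor plus [m] times its stretching, which keeps integers and makes a value of
    fractional part [m] integral. *)
Lemma mxdiff_hull C : is_corner_sum C -> asm_polytope R n (mxdiff C).
Proof.
pose bad C := [pred p : 'I_n.+1 * 'I_n.+1 | flr (C p.1 p.2) != C p.1 p.2].
move: {2}#|bad C| (leqnn #|bad C|) => k; elim: k C => [|k IH] C badC HC.
  apply: subset_convex_hull; apply: mxdiff_asm => // i j ni nj.
  move: badC; rewrite leqn0 => /eqP/card0_eq badC; apply/eqP.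
  by have := badC (Ordinal (ni : (i < n.+1)%N), Ordinal (nj : (j < n.+1)%N));
    rewrite inE /= => /negbT; rewrite negbK.
have flC : is_asm (mxdiff (fun i j => flr (C i j))).
  apply: mxdiff_asm => [|i j _ _]; last exact: flr_flr.
  apply: is_corner_sum_comp => // [m|i j i' j' _ _ _ _]; first exact: flr_nat.
  by move=> /flr_step[]->; rewrite ?subrr ?lexx ?ler01 // addrC addKr ler01 lexx.
pose fr (p : 'I_n.+1 * 'I_n.+1) : R := C p.1 p.2 - flr (C p.1 p.2).
have [q _ qmax] := arg_maxP fr (isT : xpredT (ord0 : 'I_n.+1, ord0 : 'I_n.+1)).
set m := fr q in qmax.
have m_lt1 : m < 1 by rewrite /m /fr; have := flr_gt (C q.1 q.2); lra.
have frm i j : (i <= n)%N -> (j <= n)%N -> C i j - flr (C i j) <= m.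
  by move=> ni nj; apply: (qmax (Ordinal (ni : (i < n.+1)%N), Ordinal (nj : (j < n.+1)%N))).
have [m_le0|m_gt0] := leP m 0.
  apply: subset_convex_hull; apply: mxdiff_asm => // i j ni nj.
  by have := frm _ _ ni nj; have := flr_le (C i j); lra.
have stretch_int x : flr x = x -> stretch m x = x.
  by rewrite /stretch => ->; rewrite subrr mul0r addr0.
have HC' : is_corner_sum (fun i j => stretch m (C i j)).
  apply: is_corner_sum_comp => // [l|i j i' j' *]; first by rewrite stretch_int ?flr_nat.
  by apply: stretch_step; rewrite ?frm.
have hullC' : asm_polytope R n (mxdiff (fun i j => stretch m (C i j))).
  apply: IH => //; rewrite -ltnS; apply: leq_trans _ badC.
  apply: proper_card; apply/properP; split.
    apply/fintype.subsetP => p; rewrite !inE; apply: contra => /eqP Hp.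
    by rewrite stretch_int ?Hp.
  exists q; rewrite !inE.
    by apply: contraTneq m_gt0 => qE; rewrite /m /fr qE subrr ltxx.
  rewrite negbK /stretch -/(fr q) -/m divff ?lt0r_neq0 //.
  have -> : flr (C q.1 q.2) + 1 = (Num.floor (C q.1 q.2) + 1)%:~R by rewrite intrD.
  by rewrite flr_int.
have -> : mxdiff C = (1 - m) *: mxdiff (fun i j => flr (C i j))
                 + (1 - (1 - m)) *: mxdiff (fun i j => stretch m (C i j)).
  apply/matrixP => r c; rewrite !mxE /stretch; field.
  by rewrite gt_eqF.
apply: convex_hull_convex => //; first lra.
exact: subset_convex_hull.
Qed.

Definition corner_sum A (i j : nat) : R :=
  \sum_(c < n | (c < j)%N) psum (fun r => A r c) i.

Lemma corner_sum_exchange A i j :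
  corner_sum A i j = \sum_(r < n | (r < i)%N) psum (fun c => A r c) j.
Proof. by rewrite /corner_sum /psum exchange_big. Qed.

Lemma corner_sumSr A i (c : 'I_n) :
  corner_sum A i c.+1 = corner_sum A i c + psum (fun r => A r c) i.
Proof. exact: (psumS (fun c => psum (fun r => A r c) i)). Qed.

Lemma corner_sumSl A (r : 'I_n) j :
  corner_sum A r.+1 j = corner_sum A r j + psum (fun c => A r c) j.
Proof. rewrite !corner_sum_exchange; exact: (psumS (fun r => psum (fun c => A r c) j)). Qed.

Lemma corner_sumK A : mxdiff (corner_sum A) = A.
Proof.
by apply/matrixP => r c; rewrite mxE !corner_sumSl psumS; ring.
Qed.

(** Partial row and column sums are the differences between neighbouring corner sums. *)
Lemma asm_polytope_psum A :
    (forall r, \sum_c A r c = 1) -> (forall c, \sum_r A r c = 1) ->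
    (forall r j, 0 <= psum (fun c => A r c) j <= 1) ->
    (forall c i, 0 <= psum (fun r => A r c) i <= 1) ->
  asm_polytope R n A.
Proof.
move=> A1 A1' rowA colA; rewrite -(corner_sumK A); apply: mxdiff_hull.
have ordsum i : (i <= n)%N -> \sum_(r < n | (r < i)%N) (1 : R) = i%:R.
  by move=> ni; rewrite sumr_const -sum1_card (big_ord_narrow ni) sum1_card card_ord.
split; first split.
- by move=> j; rewrite /corner_sum big1 // => c _; rewrite psum0.
- by move=> i; rewrite corner_sum_exchange big1 // => c _; rewrite psum0.
- move=> i ni; rewrite corner_sum_exchange; under eq_bigr do rewrite psum_full // A1.
  exact: ordsum.
- move=> i ni; rewrite /corner_sum; under eq_bigr do rewrite psum_full // A1'.
  exact: ordsum.
- by move=> i j ni _; rewrite (corner_sumSl A (Ordinal ni)) addrC addKr.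
- by move=> i j _ nj; rewrite (corner_sumSr A i (Ordinal nj)) addrC addKr.
Qed.

End CornerSums.

(** * Quarter turns and the four sides *)

Section Rotation.
Variables (R : realType) (n : nat).
Implicit Types A : 'M[R]_n.

(** Counterclockwise turn: the right border becomes the top row. *)
Definition mxrot A : 'M[R]_n := \matrix_(i, j) A j (rev_ord i).

Lemma rot2E A i j : iter 2 mxrot A i j = A (rev_ord i) (rev_ord j).
Proof. by rewrite /= !mxE. Qed.

Lemma rot3E A i j : iter 3 mxrot A i j = A (rev_ord j) i.
Proof. by rewrite iterS mxE rot2E rev_ordK. Qed.

Lemma rot4 A : iter 4 mxrot A = A.
Proof. by apply/matrixP => i j; rewrite iterS mxE rot3E rev_ordK. Qed.

Lemma rot_mod4 A g : iter g mxrot A = iter (g %% 4) mxrot A.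
Proof.
rewrite {1}(divn_eq g 4) addnC iterD; congr (iter _ _ _).
by elim: (g %/ 4)%N => // k IH; rewrite mulSn addnC iterD rot4.
Qed.

Lemma iter_rot_linear g (a : R) A B :
  iter g mxrot (a *: A + B) = a *: iter g mxrot A + iter g mxrot B.
Proof. by elim: g => //= g ->; apply/matrixP => i j; rewrite !mxE. Qed.

Definition unit_sums A : Prop :=
  (forall r, \sum_c A r c = 1) /\ (forall c, \sum_r A r c = 1).

Lemma unit_sums_rot A : unit_sums A -> unit_sums (mxrot A).
Proof.
move=> [rA cA]; split=> r.
  by under eq_bigr do rewrite mxE; rewrite cA.
under eq_bigr do rewrite mxE.
by rewrite -[RHS](rA r) [RHS](reindex_inj rev_ord_inj).
Qed.

Lemma unit_sums_iter_rot g A : unit_sums A -> unit_sums (iter g mxrot A).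
Proof. by move=> uA; elim: g => //= g; apply: unit_sums_rot. Qed.

(* Sum of the first [i] entries of a line, read from the top, right, bottom or left
   border according to [g] modulo 4; the line is column [j] of the rotated matrix. *)
Definition side g A (j : 'I_n) i : R := psum (fun r => iter g mxrot A r j) i.

Lemma side_linear g j i (a : R) A B :
  side g (a *: A + B) j i = a * side g A j i + side g B j i.
Proof.
rewrite /side iter_rot_linear /psum mulr_sumr -big_split /=.
by apply: eq_bigr => r _; rewrite !mxE.
Qed.

Lemma side_mod4 g A j i : side g A j i = side (g %% 4) A j i.
Proof. by rewrite /side rot_mod4. Qed.

Lemma side_iter g h A j i : side g (iter h mxrot A) j i = side (g + h) A j i.
Proof. by rewrite /side iterD. Qed.

Lemma side1E A j i : side 1 A j i = psum (fun r => A j (rev_ord r)) i.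
Proof. by apply: eq_psum => r; rewrite mxE. Qed.

Lemma side2E A j i :
  side 2 A j i = psum (fun r => A (rev_ord r) (rev_ord j)) i.
Proof. by apply: eq_psum => r; rewrite rot2E. Qed.

Lemma side3E A j i : side 3 A j i = psum (fun r => A (rev_ord j) r) i.
Proof. by apply: eq_psum => r; rewrite rot3E. Qed.

Lemma side1_rev A j i : unit_sums A ->
  side 1 A j i = 1 - psum (fun c => A j c) (n - i).
Proof. by move=> [rA _]; rewrite side1E (psum_rev (fun c => A j c)) rA. Qed.

Lemma side2_rev A j i : unit_sums A ->
  side 2 A j i = 1 - psum (fun r => A r (rev_ord j)) (n - i).
Proof.
by move=> [_ cA]; rewrite side2E (psum_rev (fun r => A r (rev_ord j))) cA.
Qed.

Lemma asm_unit_sums A : is_asm A -> unit_sums A.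
Proof. by case. Qed.

(** Sums read from the right or bottom are 1 minus partial sums from the opposite border, so both
    bounds of [alternates_psum] serve. *)
Lemma asm_side_ge0 A g j i : is_asm A -> 0 <= side g A j i.
Proof.
move=> asmA; have uA := asm_unit_sums asmA; have [A01 rA cA altr altc] := asmA.
have rowA r := alternates_psum (A01 r) (rA r) (altr r).
have colA c := alternates_psum (fun r => A01 r c) (cA c) (altc c).
rewrite side_mod4; have := ltn_pmod g (isT : 0 < 4)%N.
case: (g %% 4)%N => [|[|[|[|//]]]] _.
- by have /andP[] := colA j i.
- by rewrite side1_rev // subr_ge0; have /andP[] := rowA j (n - i)%N.
- by rewrite side2_rev // subr_ge0; have /andP[] := colA (rev_ord j) (n - i)%N.
- by rewrite side3E; have /andP[] := rowA (rev_ord j) i.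
Qed.

Lemma asm_polytope_side A : unit_sums A ->
  (forall g j i, 0 <= side g A j i) -> asm_polytope R n A.
Proof.
move=> uA sA; have [rA cA] := uA.
(* By truncated subtraction [n - (n - i)] is the minimum of [i] and [n], and partial sums are
   constant from [n] on. *)
have psum_min (f : 'I_n -> R) i : psum f i = psum f (n - (n - i)).
  by apply: eq_bigl => l; have := ltn_ord l; lia.
apply: asm_polytope_psum => // [r j|c i]; apply/andP; split.
- by have := sA 3%N (rev_ord r) j; rewrite side3E rev_ordK.
- by rewrite psum_min -subr_ge0 -side1_rev.
- exact: (sA 0%N c i).
- by rewrite psum_min -subr_ge0 -[c]rev_ordK -side2_rev.
Qed.

(** Direction space of the matrices with unit sums; products with all-ones vectors compute row and
    column sums. *)
Definition zero_sums : {vspace 'M[R]_n} :=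
  (lker (linfun (mulmxr (const_mx 1 : 'cV[R]_n))) :&:
   lker (linfun (mulmx (const_mx 1 : 'rV[R]_n))))%VS.

Lemma zero_sumsP A : reflect (unit_sums A) (A - 1%:M \in zero_sums).
Proof.
rewrite memv_cap !memv_ker !lfunE /= mulmxBl mulmxBr mul1mx mulmx1 !subr_eq0.
apply: (iffP andP) => [[/eqP/matrixP rA /eqP/matrixP cA]|[rA cA]].
  split=> [r|c].
    by have := rA r 0; rewrite !mxE => <-; apply: eq_bigr => c _; rewrite mxE mulr1.
  by have := cA 0 c; rewrite !mxE => <-; apply: eq_bigr => r _; rewrite mxE mul1r.
split; apply/eqP/matrixP => i j; rewrite !mxE.
  by rewrite -[RHS](rA i); apply: eq_bigr => c _; rewrite mxE mulr1.
by rewrite -[RHS](cA j); apply: eq_bigr => c _; rewrite mxE mul1r.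
Qed.

End Rotation.

(** * Reduction to the irredundant inequalities *)

Section Facets.
Variables (R : realType) (m : nat).
Local Notation n := m.+3.
Implicit Types A : 'M[R]_n.

(* [None] stands for the top left corner entry, [Some (i, j)] for the top [i.+1]
   entries of the inner column [j.+1]; the other three sides follow by rotation. *)
Local Notation seg_index := (option ('I_m.+1 * 'I_m.+1)).

Definition seg (o : seg_index) : 'I_n * 'I_n :=
  if o is Some (i, j) then (inord i, inord j.+1) else (ord0, ord0).

Lemma segP o : [\/ o = None /\ seg o = (ord0, ord0)
  | ((seg o).1 <= m)%N /\ (0 < (seg o).2 <= m.+1)%N].
Proof.
case: o => [[i j]|]; [right|by left].
have i_lt := ltn_ord i; have j_lt := ltn_ord j.
by rewrite /= !inordK //; lia.
Qed.

Lemma seg_surj (i : nat) (j : 'I_n) : (i <= m)%N -> (0 < j <= m.+1)%N ->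
  exists2 o, ((seg o).1 : nat) = i & (seg o).2 = j.
Proof.
move=> im /andP[j0 jm]; exists (Some (inord i, inord j.-1)) => /=.
  by rewrite !inordK //; lia.
by apply: val_inj; rewrite /= !inordK //; lia.
Qed.

Lemma seg_inj : injective seg.
Proof.
move=> [[i j]|] [[i' j']|] //= [].
- have [i_lt j_lt] := (ltn_ord i, ltn_ord j).
  have [i_lt' j_lt'] := (ltn_ord i', ltn_ord j').
  move=> /(congr1 val) /= + /(congr1 val) /=.
  rewrite !inordK //; try lia; move=> ii' [jj'].
  by congr (Some (_, _)); apply: val_inj.
- by have j_lt := ltn_ord j; move=> _ /(congr1 val); rewrite /= inordK //; lia.
- by have j_lt := ltn_ord j'; move=> _ /(congr1 val); rewrite /= inordK //; lia.
Qed.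

(** [(seg k.2).1] is the index of the segment's last row, hence the successor for its length. *)
Definition ineq (k : 'I_4 * seg_index) A : R :=
  side k.1 A (seg k.2).2 (seg k.2).1.+1.

Fact ineq_is_linear k : linear_for *%R (ineq k).
Proof. by move=> a A B; rewrite /ineq side_linear. Qed.

HB.instance Definition _ k :=
  GRing.isLinear.Build R 'M[R]_n R *%R (ineq k) (ineq_is_linear k).

(** Inner entries are segments of length one; the right corner is the left corner of the turned
    matrix. *)
Lemma border_ge0 A (j : 'I_n) :
  (forall g o, 0 <= side g A (seg o).2 (seg o).1.+1) -> 0 <= A ord0 j.
Proof.
move=> sA; have side01 g c : side g A c 1 = iter g (@mxrot _ _) A ord0 c.
  by rewrite /side (psumS _ (ord0 : 'I_n)) psum0 add0r.
have [j0|j0] := posnP j.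
  have -> : j = ord0 by apply: val_inj.
  by have := sA 0%N None; rewrite side01.
have [jm|jm] := leqP j m.+1.
  have [|o oi oj] := @seg_surj 0 j (leq0n m); first by rewrite j0.
  by have := sA 0%N o; rewrite oi oj side01.
have := sA 1%N None; rewrite side01 /= mxE.
by have -> : rev_ord ord0 = j by apply: val_inj => /=; have := ltn_ord j; lia.
Qed.

(** Outer columns have nonnegative entries. In an inner column, length [n - 1] leaves 1 minus a
    bottom entry, at most 1 since the bottom row is nonnegative with sum 1; shorter nonempty
    segments are hypotheses. *)
Lemma top_side_ge0 A (j : 'I_n) i : unit_sums A ->
  (forall g o, 0 <= side g A (seg o).2 (seg o).1.+1) -> 0 <= side 0 A j i.
Proof.
move=> [rA cA] sA.
have border h c : 0 <= iter h (@mxrot _ _) A ord0 c.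
  by apply: border_ge0 => g o; rewrite side_iter; apply: sA.
have [j0|j0] := posnP j.
  have -> : j = ord0 by apply: val_inj.
  by apply: psum_ge0 => r; have := border 3%N (rev_ord r); rewrite rot3E rev_ordK.
have [jm|jm] := leqP j m.+1; last first.
  have -> : j = rev_ord ord0 by apply: val_inj => /=; have := ltn_ord j; lia.
  by apply: psum_ge0 => r; have := border 1%N r; rewrite /= mxE.
have [ni|] := leqP n i; first by rewrite /side psum_full // cA.
rewrite ltnS leq_eqVlt => /orP[/eqP->|].
  have := psumS (fun r => A r j) ord_max; rewrite psum_full //= cA => /esym E.
  have -> : side 0 A j m.+2 = 1 - A ord_max j by rewrite -E addrK.
  rewrite subr_ge0 -(rA ord_max) (bigD1 j) //= lerDl sumr_ge0 // => c _.
  have := border 2%N (rev_ord c); rewrite rot2E rev_ordK.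
  by have -> : rev_ord ord0 = ord_max :> 'I_n by apply: val_inj => /=; lia.
case: i => [|i]; first by rewrite /side psum0.
rewrite !ltnS => im; have [|o oi oj] := @seg_surj i j im; first by rewrite j0.
by rewrite -oi -oj; apply: sA.
Qed.

Lemma asm_polytopeP A : asm_polytope R n A <->
  (A - 1%:M \in zero_sums R n /\ forall k, 0 <= ineq k A).
Proof.
split=> [hA|[/zero_sumsP uA sA]].
  split; first by apply: convex_hull_subv hA => B /asm_unit_sums/zero_sumsP.
  by move=> k; apply: convex_hull_ge0 hA => B asmB; apply: asm_side_ge0.
have sA' g o : 0 <= side g A (seg o).2 (seg o).1.+1.
  by rewrite side_mod4; apply: (sA (Ordinal (ltn_pmod g (isT : 0 < 4)%N), o)).
apply: asm_polytope_side => // g j i.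
(* Every side is the top side of a turned matrix, which satisfies the same hypotheses. *)
rewrite -[g]add0n -side_iter; apply: top_side_ge0 => [|h o].
  exact: unit_sums_iter_rot.
by rewrite side_iter.
Qed.

(** * Points tight for a single inequality *)

Section Witness.
Variable o : seg_index.

Let i : nat := (seg o).1.
Let j : nat := (seg o).2.
(** [a] spreads the unit sum of column [j] over the [n - 1 - i] rows below row [i]; [b] spreads that
    of a row over the [n - 1] other columns. *)
Let a : R := (m.+2 - i)%:R^-1.
Let b : R := m.+2%:R^-1.

(* Without the last summand this is a nonnegative matrix vanishing exactly on the
   top [i.+1] entries of column [j]; the last summand makes the shorter top sums
   of that column positive. *)
Definition witness : 'M[R]_n := \matrix_(r, c)
  ((if (c : nat) == j then if (r <= i)%N then 0 else a
    else if (r <= i)%N then b else (1 - a) * b) +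
   b / 8 * ((((c : nat) == j)%:R - ((c : nat) == j.+1)%:R) *
            (((r : nat) == 0)%:R - ((r : nat) == i)%:R))).

Let i_le : (i <= m)%N.
Proof. by rewrite /i; have [[_ ->]|[]] := segP o. Qed.

Let j_le : (j <= m.+1)%N.
Proof. by rewrite /j; have [[_ ->]|[_ /andP[]]] := segP o. Qed.

(** The nonzero entries before perturbation are [a], [b] and [(1 - a) * b], all at least [b / 2] and
    so well above [b / 8]. At least two rows lie below row [i], whence [a <= 1 / 2]. *)
Let ab_bounds : [/\ 0 < b, b <= a, a <= 1 / 2 & b / 2 <= (1 - a) * b].
Proof.
have b_gt0 : 0 < b by rewrite invr_gt0 ltr0n.
have a_le : a <= 1 / 2 by rewrite mul1r lef_pV2 ?posrE ?ltr0n ?ler_nat //; lia.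
split=> //; first by rewrite lef_pV2 ?posrE ?ltr0n ?ler_nat; lia.
by rewrite mulrC ler_wpM2r ?(ltW b_gt0) //; lra.
Qed.

Lemma witness_gt (r c : 'I_n) : (c : nat) != j \/ (i < r)%N -> b / 8 < witness r c.
Proof.
have [b_gt0 b_le_a a_le ab_ge] := ab_bounds.
rewrite mxE; have [cj|cj] := eqVneq (c : nat) j => -[//|].
  move=> ir; rewrite leqNgt ir /= !(gtn_eqF ir) (gtn_eqF (leq_ltn_trans _ ir)) //.
  by rewrite subrr !mulr0 addr0; lra.
all: move=> _; case: ifP => ri; case: eqP => ?; case: eqP => ?; case: eqP => ? //=; lra.
Qed.

Lemma witness_ge0 (r c : 'I_n) : (c : nat) != j \/ (r : nat) != i -> 0 <= witness r c.
Proof.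
have [b_gt0 b_le_a a_le ab_ge] := ab_bounds.
have [cj|cj _] := eqVneq (c : nat) j; last first.
  by apply: ltW; apply: lt_trans (witness_gt (or_introl cj)); lra.
case=> [//|ri]; have [ir|ri'] := ltnP i r.
  by apply: ltW; apply: lt_trans (witness_gt (or_intror ir)); lra.
rewrite mxE cj eqxx ri' (negbTE ri) subr0 add0r.
have -> : (j == j.+1) = false by lia.
by rewrite subr0 mul1r mulr_ge0 ?ler0n //; lra.
Qed.

Lemma witness_ge (r c : 'I_n) : - (b / 8) <= witness r c.
Proof.
have [b_gt0 b_le_a a_le ab_ge] := ab_bounds.
have [cj|cj] := eqVneq (c : nat) j; last first.
  by apply: le_trans (witness_ge0 (or_introl cj)); lra.
have [ri|ri] := eqVneq (r : nat) i; last first.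
  by apply: le_trans (witness_ge0 (or_intror ri)); lra.
rewrite mxE cj ri !eqxx leqnn add0r.
have -> : (j == j.+1) = false by lia.
by case: eqP => _ /=; lra.
Qed.

Let sum_eq (k : nat) : (k < n)%N -> \sum_(l < n) ((l : nat) == k)%:R = 1 :> R.
Proof.
move=> kn; rewrite (bigD1 (Ordinal kn)) //= eqxx big1 ?addr0 // => l.
by rewrite -val_eqE => /= /negbTE->.
Qed.

Lemma witness_unit_sums : unit_sums witness.
Proof.
have aE : (m.+2 - i)%:R * a = 1 by rewrite mulfV // pnatr_eq0; lia.
have bE : m.+2%:R * b = 1 by rewrite mulfV // pnatr_eq0.
have natE : (m.+2 - i)%:R + i%:R = m.+2%:R :> R by rewrite -natrD subnK //; lia.
have [jn j1n i_n] : [/\ (j < n)%N, (j.+1 < n)%N & (i < n)%N] by split; lia.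
have sumif (x y : R) : \sum_(c < n) (if (c : nat) == j then x else y) = x + m.+2%:R * y.
  rewrite (bigD1 (Ordinal jn)) //= eqxx; congr (_ + _).
  under eq_bigr => c do [rewrite -val_eqE /= => /negbTE->].
  rewrite sumr_const mulr_natl; congr (_ *+ _).
  by rewrite cardC1 card_ord.
have sumle (x y : R) : \sum_(r < n) (if (r <= i)%N then x else y) =
    (i.+1)%:R * x + (m.+2 - i)%:R * y.
  have -> : \sum_(r < n) (if (r <= i)%N then x else y) =
            \sum_(0 <= r < n) (if (r <= i)%N then x else y) by rewrite big_mkord.
  rewrite (@big_cat_nat _ _ _ i.+1) //=.
  congr (_ + _).
    transitivity (\sum_(0 <= r < i.+1) x); last by rewrite sumr_const_nat mulr_natl.
    by apply: eq_big_nat => r ri; rewrite (_ : (r <= i)%N).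
  transitivity (\sum_(i.+1 <= r < n) y); last by rewrite sumr_const_nat mulr_natl.
  by apply: eq_big_nat => r /andP[ri _]; rewrite leqNgt ri.
split=> [r|c].
  under eq_bigr do rewrite mxE.
  rewrite big_split /= -mulr_sumr -mulr_suml sumrB !sum_eq //.
  (* The perturbations in columns [j] and [j.+1] cancel. *)
  rewrite subrr mul0r mulr0 addr0 sumif; case: ifP => _; first by rewrite add0r.
  by rewrite mulrCA bE; ring.
under eq_bigr do rewrite mxE.
rewrite big_split /= -mulr_sumr -mulr_sumr sumrB !sum_eq //.
rewrite subrr !mulr0 addr0; case: eqP => _; rewrite sumle.
  by rewrite mulr0 add0r.
rewrite mulrA mulrBr mulr1 aE -mulrDl -natr1 -[RHS]bE -natE; congr (_ * _); ring.
Qed.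

Lemma witness_tight : side 0 witness (seg o).2 i.+1 = 0.
Proof.
rewrite /side /psum /=.
under eq_bigr => r ri do rewrite mxE -/j eqxx -ltnS ri add0r.
rewrite -!mulr_sumr sumrB.
(* Only the perturbation is left; its terms at rows 0 and [i] both lie in the segment and cancel. *)
have H (k : nat) : (k <= i)%N -> \sum_(l < n | (l < i.+1)%N) ((l : nat) == k)%:R = 1 :> R.
  move=> ki; have kn : (k < n)%N by lia.
  rewrite (bigD1 (Ordinal kn)) //= eqxx big1 ?addr0 // => l /andP[_].
  by rewrite -val_eqE => /= /negbTE->.
by rewrite !H // subrr !mulr0.
Qed.

(** Only entry [(i, j)] can be negative, by at most [b / 8]. Each segment here either has an entry
    above [b / 8] or is a shorter top segment of column [j], positive through its first entry. *)
Lemma witness_slack g o' : (g < 4)%N -> (g, o') != (0%N, o) ->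
  0 < side g witness (seg o').2 (seg o').1.+1.
Proof.
have [b_gt0 b_le_a a_le ab_ge] := ab_bounds.
have e0 : 0 <= b / 8 by lra.
move=> g4 neq; case: g g4 neq => [|[|[|[|//]]]] _ neq.
- have [jj|jj] := eqVneq ((seg o').2 : nat) j; last first.
    apply: (@psum_gt0 _ _ _ _ ord0 ord0 (b / 8)) => //=.
    + by apply: witness_gt; left.
    + by move=> l _ _; apply: witness_ge0; left.
    + exact: witness_ge.
  have ii : ((seg o').1 : nat) != i.
    apply: contra neq => /eqP ii; apply/eqP; congr (_, _); apply: seg_inj.
    by move: ii jj; rewrite /i /j; case: (seg o') (seg o) => ? ? [? ?] /= /val_inj-> /val_inj->.
  have [lt|ge] := ltnP i (seg o').1.
    have i1n : (i.+1 < n)%N by lia.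
    have in_ : (i < n)%N by lia.
    apply: (@psum_gt0 _ _ _ _ (Ordinal i1n) (Ordinal in_) (b / 8)) => //=.
    + by apply: witness_gt; right.
    + by move=> l _; rewrite -val_eqE => /= li; apply: witness_ge0; right.
    + exact: witness_ge.
  (* The segment stops above row [i], so [i] is nonzero and the top entry is exactly [b / 8]. *)
  have w0 : 0 < witness ord0 (seg o').2.
    rewrite mxE jj eqxx /=; have -> : (j == j.+1) = false by lia.
    have -> : (0%N == i) = false by lia.
    by rewrite !subr0 !mulr1 add0r; lra.
  apply: (@psum_gt0 _ _ _ _ ord0 ord0 0) => //=; last by rewrite oppr0 ltW.
  by move=> l li _; apply: witness_ge0; right; lia.
- rewrite side1E; apply: (@psum_gt0 _ _ _ _ ord0 (rev_ord (seg o).2) (b / 8)) => //=.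
  + by apply: witness_gt; left => /=; lia.
  + move=> l _ lj; apply: witness_ge0; left; apply: contra lj => /eqP lj.
    by apply/eqP; rewrite -[l]rev_ordK; congr rev_ord; apply: val_inj.
  + exact: witness_ge.
- rewrite side2E; apply: (@psum_gt0 _ _ _ _ ord0 (rev_ord (seg o).1) (b / 8)) => //=.
  + by apply: witness_gt; right => /=; lia.
  + move=> l _ lj; apply: witness_ge0; right; apply: contra lj => /eqP lj.
    by apply/eqP; rewrite -[l]rev_ordK; congr rev_ord; apply: val_inj.
  + exact: witness_ge.
- rewrite side3E; apply: (@psum_gt0 _ _ _ _ ord0 (seg o).2 (b / 8)) => //=.
  (* The segment starts in column 0. This is column [j] only for the corner, and then its row lies
     below row 0. *)
  + apply: witness_gt => /=; rewrite /i /j.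
    have [[_ ->]|[_ /andP[j0 _]]] := segP o; last by left; lia.
    by right => /=; have [[_ ->]|[_ /andP[_ ?]]] := segP o' => /=; lia.
  + by move=> l _ lj; apply: witness_ge0; left; rewrite val_eqE.
  + exact: witness_ge.
Qed.

End Witness.

(** * Rotated witnesses and the facet count *)

Definition rot_witness (k : 'I_4 * seg_index) : 'M[R]_n :=
  iter (4 - k.1) (@mxrot _ _) (witness k.2).

Lemma ineq_rot_witness k : ineq k (rot_witness k) = 0.
Proof.
(* The [4 - g] turns of the witness and the [g] turns of side [g] make a full rotation. *)
rewrite /ineq side_iter subnKC; last exact: ltnW.
by rewrite side_mod4 modnn witness_tight.
Qed.

Lemma ineq_rot_witness_gt0 k k' : k' != k -> 0 < ineq k' (rot_witness k).
Proof.
move=> kk'; rewrite /ineq side_iter side_mod4; apply: witness_slack.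
  by rewrite ltn_pmod.
apply: contra kk' => /eqP[g0 oE]; apply/eqP.
case: k k' g0 oE => [g o] [g' o'] /= g0 ->; congr (_, _); apply: val_inj => /=.
(* For [g] and [g'] below 4, [g' + (4 - g)] is divisible by 4 only if [g' = g]. *)
by have := ltn_ord g; have := ltn_ord g'; lia.
Qed.

Lemma rot_witness_polytope k : asm_polytope R n (rot_witness k).
Proof.
apply/asm_polytopeP; split.
  by apply/zero_sumsP/unit_sums_iter_rot/witness_unit_sums.
move=> k'; have [->|kk'] := eqVneq k' k; first by rewrite ineq_rot_witness.
by apply: ltW; apply: ineq_rot_witness_gt0.
Qed.

Lemma card_asm_facets :
  ([set F | is_facet (asm_polytope R n) F] #= `I_(4 * (m.+1 * m.+1).+1))%card.
Proof.
have cardK : #|{: 'I_4 * seg_index}| = (4 * (m.+1 * m.+1).+1)%N.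
  by rewrite card_prod card_option card_prod !card_ord.
rewrite -cardK; apply: (@card_facets R _ _ 1%:M (zero_sums R n) _ ineq rot_witness).
- exact: asm_polytopeP.
- exact: rot_witness_polytope.
- exact: ineq_rot_witness.
- exact: ineq_rot_witness_gt0.
- by rewrite cardK.
Qed.

End Facets.

Local Open Scope card_scope.

Theorem theorem3p3 (R : realType) (n : nat) (hn : (3 <= n)%N) :
  [set F : set 'M[R]_n | is_facet (asm_polytope R n) F]
    #= `I_(4 * ((n - 2) ^ 2 + 1))%N.
Proof.
case: n hn => [|[|[|m]]] // _.
by have := card_asm_facets R m; rewrite -mulnn addn1 !subSS subn0.
Qed.
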